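(* Let $\{M(t)\}_{t\ge0}$ be a GCP which performs $k$ kinds of jumps of amplitude $1,\dots,k$ with positive rates $\lambda_1,\dots,\lambda_k$, let $q\ge2$, let $p_1,\dots,p_q>0$ with $\sum_{i=1}^{q}p_i=1$, and let $\{M_1(t)\}_{t\ge0},\dots,\{M_q(t)\}_{t\ge0}$ be the Type II split components of $\{M(t)\}_{t\ge0}$ obtained by rolling a $q$-faced die with face probabilities $p_1,\dots,p_q$. Then for each $i\in\{1,\dots,q\}$, $\{M_i(t)\}_{t\ge0}$ is a GCP which performs $k$ kinds of jumps of size $s\in\{1,\dots,k\}$ with positive rates $$\sum_{j=s}^{k}\ \sum_{\substack{(j_1,\dots,j_q)\in\mathbb{N}_0^q\\ j_1+\dots+j_q=j,\ j_i=s}} j!\prod_{r=1}^{q}\frac{p_r^{j_r}}{j_r!}\,\lambda_j .$$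
   Context: $\mathbb{N}_0=\{0,1,2,\dots\}$. A counting process is an $\mathbb{N}_0$-valued process with nondecreasing right-continuous paths. A generalized counting process (GCP) performing $k$ kinds of jumps of amplitude $1,2,\dots,k$ with positive rates $\lambda_1,\dots,\lambda_k$ is a counting process $\{M(t)\}_{t\ge0}$ with $M(0)=0$ and independent and stationary increments such that, as $h\to0^+$, $\mathrm{Pr}\{M(t+h)=n+j\mid M(t)=n\}$ equals $1-\sum_{i=1}^k\lambda_i h+o(h)$ for $j=0$, $\lambda_jh+o(h)$ for $1\le j\le k$, and $o(h)$ for $j\ge k+1$. Type II splitting with a $q$-faced die: let $T_1<T_2<\cdots$ be the successive jump times of $\{M(t)\}_{t\ge0}$ and $J_1,J_2,\dots\in\{1,\dots,k\}$ the corresponding jump sizes. At each jump time $T_n$ the die is rolled $J_n$ times, all rolls being independent of each other and of $\{M(t)\}_{t\ge0}$, each showing face $i$ with probability $p_i$. If face $i$ appears $j_i$ times (so $\sum_i j_i=J_n$), a jump of size $j_i$ is registered in $\{M_i(t)\}_{t\ge0}$ at time $T_n$ (no jump if $j_i=0$). That is, with i.i.d. variables $\xi_{n,m}$ with $\mathrm{Pr}\{\xi_{n,m}=i\}=p_i$, independent of $\{M(t)\}_{t\ge0}$, $M_i(t)=\sum_{n:T_n\le t}\sum_{m=1}^{J_n}\mathbf{1}\{\xi_{n,m}=i\}$. *)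

(* Defs.v *)
From HB Require Import structures.
From mathcomp Require Import all_boot all_order all_algebra finmap.
From mathcomp Require Import all_classical all_reals all_analysis.

Set Implicit Arguments.
Unset Strict Implicit.
Unset Printing Implicit Defensive.
Import Order.TTheory GRing.Theory Num.Theory.
Import numFieldNormedType.Exports.

Local Open Scope classical_set_scope.
Local Open Scope ring_scope.

Section Independence.
Context (R : realType) (d : measure_display) (Omega : measurableType d).
Variable P : probability Omega R.

(* All variables below take values in nat or 'I_q, where every subset is
   measurable. *)
Definition events_of (T : Type) (X : Omega -> T) : set (set Omega) :=
  preimage_set_system setT X [set: set T].

(* The sigma-algebra generated by the variables X t, t in D. *)
Definition sigma_gen (T I : Type) (D : set I) (X : I -> Omega -> T) :
    set (set Omega) :=
  <<s \bigcup_(t in D) events_of (X t) >>.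

Definition mutually_independent (T : Type) (I : choiceType)
    (X : I -> Omega -> T) : Prop :=
  forall (J : {fset I}) (A : I -> set Omega),
    (forall i, i \in J -> events_of (X i) (A i)) ->
    P (\bigcap_(i in [set` J]) A i) = (\prod_(i <- J) P (A i))%E.

Definition independent_systems (F G : set (set Omega)) : Prop :=
  forall A B, F A -> G B -> P (A `&` B) = (P A * P B)%E.

(* Only meaningful when P B is nonzero. *)
Definition cond_prob (A B : set Omega) : R :=
  fine (P (A `&` B)) / fine (P B).

End Independence.

Section GCP.
Context (R : realType) (d : measure_display) (Omega : measurableType d).
Variable P : probability Omega R.

(* Processes are indexed by all of R; only times t >= 0 are constrained. *)
Record counting_process (M : R -> Omega -> nat) : Prop := CountingProcess {
  cp_measurable : forall t : R, 0 <= t -> measurable_fun setT (M t) ;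
  cp_nondecreasing : forall w (s t : R), 0 <= s -> s <= t -> (M s w <= M t w)%N ;
  cp_right_continuous : forall w (t : R), 0 <= t -> M s w @[s --> t^'+] --> M t w }.

(* On the paths of a counting process the truncated subtraction of nat is the
   genuine one. *)
Definition increment (M : R -> Omega -> nat) (s t : R) (w : Omega) : nat :=
  (M t w - M s w)%N.

(* A finite sequence of times is extended by a constant tail, so independence
   along infinite nondecreasing sequences is independence along finite ones. *)
Definition independent_increments (M : R -> Omega -> nat) : Prop :=
  forall t : nat -> R, 0 <= t 0%N -> nondecreasing_seq t ->
    mutually_independent P (fun n => increment M (t n) (t n.+1)).

Definition stationary_increments (M : R -> Omega -> nat) : Prop :=
  forall s t h : R, 0 <= s -> 0 <= t -> 0 <= h -> forall B : set nat,
    P (increment M s (s + h) @^-1` B) = P (increment M t (t + h) @^-1` B).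

(* Pr{M(t+h) = n+j | M(t) = n} as a function of h. *)
Definition transition_prob (M : R -> Omega -> nat) (t : R) (n j : nat) (h : R)
    : R :=
  cond_prob P [set w | M (t + h) w = (n + j)%N] [set w | M t w = n].

(* The rates are lambda 1, ..., lambda k; other values of lambda are unused. *)
Record gcp (k : nat) (lambda : nat -> R) (M : R -> Omega -> nat) : Prop := GCP {
  gcp_rates_gt0 : forall j, (1 <= j <= k)%N -> 0 < lambda j ;
  gcp_counting : counting_process M ;
  gcp_start : forall w, M 0 w = 0%N ;
  gcp_independent : independent_increments M ;
  gcp_stationary : stationary_increments M ;
  gcp_no_jump : forall (t : R) (n : nat), 0 <= t -> (0 < P [set w | M t w = n])%E ->
    transition_prob M t n 0 =
      (fun h => 1 - (\sum_(1 <= i < k.+1) lambda i) * h) +o_ (0^'+) id ;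
  gcp_jump : forall (t : R) (n : nat), 0 <= t -> (0 < P [set w | M t w = n])%E ->
    forall j, (1 <= j <= k)%N ->
    transition_prob M t n j = (fun h => lambda j * h) +o_ (0^'+) id ;
  gcp_large_jump : forall (t : R) (n : nat), 0 <= t -> (0 < P [set w | M t w = n])%E ->
    forall j, (k.+1 <= j)%N ->
    transition_prob M t n j =o_ (0^'+) id }.

End GCP.

Section Splitting.
Context (R : realType).

(* jump_time x n is T_n, with T_0 = 0 and T_n = +oo when the path x has fewer
   than n jumps. *)
Fixpoint jump_time (x : R -> nat) (n : nat) : \bar R :=
  if n is n'.+1 then
    ereal_inf [set t%:E | t in [set t |
      (jump_time x n' < t%:E)%E /\ x t <> x (fine (jump_time x n'))]]
  else 0%E.

(* J_n, meaningful for n > 0 and T_n finite. *)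
Definition jump_size (x : R -> nat) (n : nat) : nat :=
  (x (fine (jump_time x n)) - x (fine (jump_time x n.-1)))%N.

Context (d : measure_display) (Omega : measurableType d).
Variable P : probability Omega R.

(* xi n m is the face shown by roll number m+1 of the die at time T_(n+1). *)
Record die_rolls (q : nat) (p : 'I_q -> R) (M : R -> Omega -> nat)
    (xi : nat -> nat -> Omega -> 'I_q) : Prop := DieRolls {
  rolls_measurable : forall n m, events_of (xi n m) `<=` measurable ;
  rolls_law : forall n m i, P [set w | xi n m w = i] = (p i)%:E ;
  rolls_independent :
    mutually_independent P (fun nm : nat * nat => xi nm.1 nm.2) ;
  rolls_independent_process :
    independent_systems P (sigma_gen [set t : R | 0 <= t] M)
      (sigma_gen setT (fun nm : nat * nat => xi nm.1 nm.2)) }.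

(* The sum over n is finite: a counting path has finitely many jumps up to t. *)
Definition split_component (q : nat) (M : R -> Omega -> nat)
    (xi : nat -> nat -> Omega -> 'I_q) (i : 'I_q) (t : R) (w : Omega) : nat :=
  (\big[addn/0]_(n \in [set n | (jump_time (M ^~ w) n.+1 <= t%:E)%E])
     \sum_(m < jump_size (M ^~ w) n.+1) (xi n m w == i))%N.

(* In a composition of j into q parts every part is at most j, hence the finite
   index type. *)
Definition split_rate (k q : nat) (lambda : nat -> R) (p : 'I_q -> R)
    (i : 'I_q) (s : nat) : R :=
  \sum_(s <= j < k.+1)
    \sum_(f : {ffun 'I_q -> 'I_j.+1} |
          (\sum_r (f r : nat) == j)%N && (f i == s :> nat))
      j`!%:R * (\prod_r (p r ^+ f r / (f r)`!%:R)) * lambda j.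

End Splitting.

(* Main.v *)
Require Import Defs.
From mathcomp Require Import all_boot all_order all_algebra finmap.
From mathcomp Require Import all_classical all_reals all_analysis.
From mathcomp Require Import ring lra zify.

(* Number the rolls in the order in which the path of M consumes them, so that
   roll u carries M across the level u.  The pair (n, m) naming roll u depends
   only on which levels up to u the path visits, and distinct u give distinct
   pairs; since the visited levels are determined by M, the outcomes in this new
   order are again i.i.d. and independent of M.  Hence M_i (t) is the number of
   successes among the first M (t) rolls, and its increments are independent
   binomial thinnings of those of M: this gives independence and stationarity.
   Thinning turns P(M (h) = j) = lambda_j h + o(h) into
   P(M_i (h) = s) = (sum_j lambda_j Bin(j, p_i)(s)) h + o(h), the tail j > k
   being o(h) because the probabilities for j <= k sum to 1 - o(h); summing the
   multinomial law over the other faces gives Bin(j, p_i)(s). *)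

Set Implicit Arguments.
Unset Strict Implicit.
Unset Printing Implicit Defensive.
Import Order.TTheory GRing.Theory Num.Theory.
Import numFieldNormedType.Exports.

Local Open Scope classical_set_scope.
Local Open Scope ring_scope.

(** * Binomial thinning *)

Section Thinning.
Context (R : realType).
Implicit Types (p : R) (B : set nat).

(* The probability that a binomial (n, p) variable lies in B. *)
Fixpoint thin p (n : nat) B : R :=
  if n is n'.+1 then p * thin p n' [set s | B s.+1] + (1 - p) * thin p n' B
  else \1_B 0%N.

Lemma thin_set0 p n : thin p n set0 = 0.
Proof.
elim: n => [|n IHn] /=; first by rewrite indicE in_set0.
by rewrite (_ : [set s | _] = set0) ?IHn ?mulr0 ?addr0.
Qed.

Lemma thin_setT p n : thin p n [set: nat] = 1.
Proof.
elim: n => [|n IHn] /=; first by rewrite indicE in_setT.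
rewrite (_ : [set s | _] = setT) ?IHn; last by apply/seteqP; split.
ring.
Qed.

Lemma thin_ge0 p n B : 0 <= p <= 1 -> 0 <= thin p n B.
Proof.
move=> /andP[p0 p1]; elim: n B => [|n IHn] B /=; first by rewrite indicE.
by rewrite addr_ge0 // mulr_ge0 // subr_ge0.
Qed.

Lemma thin_le1 p n B : 0 <= p <= 1 -> thin p n B <= 1.
Proof.
move=> p01; elim: n B => [|n IHn] B /=; first by rewrite indicE lern1 leq_b1.
have /andP[p0 p1] := p01.
by have := IHn [set s | B s.+1]; have := IHn B; nra.
Qed.

(** Conditioning on one trial reproduces Pascal's rule. The truncated [n - s] is harmless, since the
    binomial coefficient vanishes when [s] exceeds [n]. *)
Lemma thin_set1 p n s :
  thin p n [set s] = 'C(n, s)%:R * p ^+ s * (1 - p) ^+ (n - s).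
Proof.
elim: n s => [|n IHn] s /=.
  by rewrite indicE sub0n expr0 mulr1; case: s => [|s];
    [rewrite mem_set // expr0 mulr1 | rewrite memNset // !mul0r].
case: s => [|s].
  rewrite (_ : [set s | _] = set0) ?thin_set0; last by apply/seteqP; split.
  by rewrite IHn !bin0 !subn0 exprS; ring.
rewrite (_ : [set _ | _] = [set s]); last first.
  by apply/seteqP; split => x /= [->].
rewrite !IHn subSS binS natrD.
have [ns|sn] := ltnP n s.+1; first by rewrite (@bin_small n s.+1) // exprS; ring.
have -> : (n - s = (n - s.+1).+1)%N by lia.
rewrite !exprS; ring.
Qed.

(** The binomial theorem for [(p + (1 - p)) ^ n], padded with zero terms up to [k]. It later turns
    the sum of the new rates into the no-jump coefficient. *)
Lemma sum_thin_set1 p n k : (n <= k)%N ->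
  \sum_(1 <= s < k.+1) thin p n [set s] = 1 - thin p n [set 0%N].
Proof.
move=> nk; apply/eqP; rewrite eq_sym subr_eq addrC.
rewrite -(@big_ltn _ _ _ 0 k.+1 (fun s => thin p n [set s])) //.
apply/eqP.
rewrite (@big_cat_nat _ _ _ n.+1) //= [X in _ = _ + X]big_nat_cond.
rewrite [X in _ = _ + X]big1 ?addr0; last first.
  by move=> s /andP[/andP[ns _] _]; rewrite thin_set1 bin_small // !mul0r.
rewrite -[LHS](expr1n _ n) -{1}(subrK p 1) exprDn big_mkord.
by apply/eq_bigr => s _; rewrite thin_set1 -mulr_natl; ring.
Qed.

End Thinning.

(** * The split rates as binomial mixtures of the original rates *)

Section SplitRate.
Context (R : realType).

Lemma natr_fact_neq0 n : n`!%:R != 0 :> R.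
Proof. by rewrite pnatr_eq0 -lt0n fact_gt0. Qed.

(** The exponential series of [x X], cut after degree [j]. *)
Definition exp_trunc (j : nat) (x : R) : {poly R} :=
  \poly_(a < j.+1) (x ^+ a / a`!%:R).

(** The functional equation of the exponential, by the binomial theorem. Up to degree [j] the
    truncations do not affect the coefficients, so [r] need only agree with the series of [y X]
    there. *)
Lemma coef_exp_truncM j m (x y : R) (r : {poly R}) : (m <= j)%N ->
  (forall a, (a <= j)%N -> r`_a = y ^+ a / a`!%:R) ->
  (exp_trunc j x * r)`_m = (x + y) ^+ m / m`!%:R.
Proof.
move=> mj rE; rewrite coefM addrC exprDn mulr_suml; apply: eq_bigr => a _.
have am : (a <= m)%N by rewrite -ltnS.
rewrite coef_poly ltnS (leq_trans am mj) rE; last by lia.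
rewrite -mulr_natl.
have := congr1 (fun n => n%:R : R) (bin_fact am); rewrite !natrM => <-.
have b0 : 'C(m, a)%:R != 0 :> R by rewrite pnatr_eq0 -lt0n bin_gt0.
by field; rewrite b0 !natr_fact_neq0.
Qed.

Lemma coef_prod_exp_trunc (I : Type) (p : I -> R) (s : seq I) j m : (m <= j)%N ->
  (\prod_(r <- s) exp_trunc j (p r))`_m = (\sum_(r <- s) p r) ^+ m / m`!%:R.
Proof.
elim: s m => [|r s IHs] m mj.
  by rewrite !big_nil coef1; case: m mj => [|m] _;
    rewrite ?expr0 ?expr0n ?fact0 ?divr1 ?mul0r.
by rewrite !big_cons; apply: coef_exp_truncM.
Qed.

Lemma sum_multinomial (q : nat) (p : 'I_q -> R) (i : 'I_q) j s :
  \sum_r p r = 1 -> (s <= j)%N ->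
  \sum_(f : {ffun 'I_q -> 'I_j.+1} |
          (\sum_r (f r : nat) == j)%N && (f i == s :> nat))
      j`!%:R * (\prod_r (p r ^+ f r / (f r)`!%:R)) = thin (p i) j [set s].
Proof.
move=> p1 sj.
(* Both sides are j! times the coefficient of X^j in the product of the
   exponential series of the p r, where only degree s is kept at r = i. *)
pose G r (a : 'I_j.+1) : {poly R} :=
  if (r == i) && (a != s :> nat) then 0 else (p r ^+ a / a`!%:R) *: 'X^a.
have prodE : \prod_r \sum_a G r a =
    ((p i ^+ s / s`!%:R) *: 'X^s) * \prod_(r | r != i) exp_trunc j (p r).
  rewrite (bigD1 i) //=; congr (_ * _).
    rewrite (bigD1 (inord s)) //= {1}/G eqxx inordK ?ltnS // eqxx /=.
    rewrite big1 ?addr0 // => a as_; rewrite /G eqxx /= ifT //.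
    by apply: contra as_ => /eqP <-; rewrite inord_val.
  apply: eq_bigr => r ri; rewrite /exp_trunc poly_def; apply: eq_bigr => a _.
  by rewrite /G (negbTE ri).
have := congr1 (fun P : {poly R} => j`!%:R * P`_j) prodE.
rewrite bigA_distr_bigA /= coef_sum mulr_sumr => coefE.
(* A choice [f] with [f i] different from [s] contains a zero factor; for the others, taking the
   coefficient of degree [j] enforces the sum constraint. *)
transitivity (\sum_(f : {ffun 'I_q -> 'I_j.+1})
    j`!%:R * (\prod_r G r (f r))`_j).
  rewrite big_mkcond /=; apply: eq_bigr => f _.
  have [fi|fi] := eqVneq (f i : nat) s; last first.
    rewrite andbF (bigD1 i) //= {1}/G eqxx fi /= mul0r coef0 mulr0 //.
  have -> : \prod_r G r (f r) =
      (\prod_r (p r ^+ f r / (f r)`!%:R)) *: 'X^(\sum_r f r).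
    rewrite -prodrXr -scaler_prod; apply: eq_bigr => r _.
    by rewrite /G; case: eqVneq => //= ->; rewrite fi eqxx.
  rewrite coefZ coefXn eq_sym; case: eqP => _ /=; first by rewrite mulr1.
  by rewrite mulr0 mulr0.
(* Face [i] takes degree [s]; the other faces contribute the coefficient of degree [j - s] in the
   exponential of [(1 - p i) X]. *)
rewrite {}coefE -scalerAl coefZ coefXnM ltnNge sj /=.
rewrite -big_filter coef_prod_exp_trunc ?leq_subr // big_filter thin_set1.
have -> : \sum_(r | r != i) p r = 1 - p i.
  by rewrite -p1 [in RHS](bigD1 i) //= addrAC subrr add0r.
have := congr1 (fun n => n%:R : R) (bin_fact sj); rewrite !natrM => <-.
by field; rewrite !natr_fact_neq0.
Qed.

Lemma split_rateE (k q : nat) lambda (p : 'I_q -> R) (i : 'I_q) s :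
  \sum_r p r = 1 ->
  split_rate k lambda p i s =
    \sum_(s <= j < k.+1) thin (p i) j [set s] * lambda j.
Proof.
move=> p1; apply: eq_big_nat => j /andP[sj _].
by rewrite -mulr_suml sum_multinomial.
Qed.

End SplitRate.

(** * Paths of counting processes *)

(* b v tells whether the path visits the level v; the jump that crosses the
   level u is then jump number n + 1, and u is the roll number m + 1 of it,
   where (n, m) = roll_index b u. *)
Fixpoint roll_index (b : nat -> bool) (u : nat) : nat * nat :=
  if u is v.+1 then
    if b u then ((roll_index b v).1.+1, 0%N)
    else ((roll_index b v).1, (roll_index b v).2.+1)
  else (0%N, 0%N).

(** Each step goes to the next roll of the same jump or to the first roll of the next one, so the
    index grows lexicographically. Hence no roll is used twice. *)
Lemma roll_index_lt b u v : (u < v)%N ->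
  ((roll_index b u).1 < (roll_index b v).1)%N \/
  (roll_index b u).1 = (roll_index b v).1 /\
  ((roll_index b u).2 < (roll_index b v).2)%N.
Proof.
elim: v => // v IHv; rewrite ltnS leq_eqVlt => /predU1P[->|/IHv] /=;
  case: (b v.+1) => /=; lia.
Qed.

Lemma roll_index_inj b : injective (roll_index b).
Proof.
move=> u v uv; have [/(roll_index_lt b)|/(roll_index_lt b)|//] := ltngtP u v;
  rewrite uv; lia.
Qed.

Lemma eq_roll_index b b' u : (forall v, (v <= u)%N -> b v = b' v) ->
  roll_index b u = roll_index b' u.
Proof.
elim: u => //= u IHu bb'; rewrite bb' // IHu // => v vu.
by apply: bb'; exact: leqW.
Qed.

Section Paths.
Context (R : realType).

Definition visited (x : R -> nat) (v : nat) : bool :=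
  `[< exists2 s : R, 0 <= s & x s = v >].

Context (x : R -> nat).
Hypothesis x_nd : forall s t : R, 0 <= s -> s <= t -> (x s <= x t)%N.
Hypothesis x_rc : forall t : R, 0 <= t -> x s @[s --> t^'+] --> x t.
Hypothesis x0 : x 0 = 0%N.

Lemma path_eq_right t : 0 <= t -> \forall s \near t^'+, x s = x t.
Proof. by move=> t0; have /discrete_cvg := x_rc t0. Qed.

Lemma jump_time_ge0 n : (0%:E <= jump_time x n)%E.
Proof.
elim: n => [|n IHn] //=; apply/ereal_infP => _ [t /= [nt _] <-].
exact: (le_trans IHn (ltW nt)).
Qed.

(** A later change of value makes the set defining the next jump time nonempty, and right continuity
    makes the path jump at the infimum itself. *)
Lemma jump_timeS n (a t : R) : 0 <= a -> jump_time x n = a%:E ->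
  a <= t -> x t <> x a ->
  exists b, [/\ jump_time x n.+1 = b%:E, a < b <= t, (x a < x b)%N &
    forall s : R, a <= s < b -> x s = x a].
Proof.
move=> a0 na at_ xta; rewrite /= na /=.
set A := [set t : R | _].
have At : A t.
  split => //; rewrite lte_fin lt_neqAle at_ andbT.
  by apply/eqP => e; apply: xta; rewrite e.
have lbA : lbound A a by move=> s [/= ]; rewrite lte_fin => /ltW.
have infA : has_inf A by split; [exists t|exists a].
pose b := inf A.
have ab : a <= b by apply: lb_le_inf => //; exists t.
have b0 : 0 <= b by exact: le_trans ab.
have A_lt s : a <= s -> s < b -> x s = x a.
  move=> as_ sb; apply: contrapT => xs.
  have : A s.
    split => //; rewrite lte_fin lt_neqAle as_ andbT.
    by apply/eqP => e; apply: xs; rewrite e.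
  by move=> /(ge_inf infA.2); rewrite leNgt sb.
have A_gt s : b < s -> (x a < x s)%N.
  move=> /(inf_lt infA.1)[r [ar xr] rs].
  rewrite lte_fin in ar.
  apply: (@leq_trans (x r)); last by apply: x_nd; lra.
  rewrite ltn_neqAle x_nd ?(ltW ar) // andbT.
  by apply/eqP => e; apply: xr; rewrite e.
(* Just to the right of [b] the path equals [x b], so the strict bound valid past [b] holds at
   [b]. *)
have xb : (x a < x b)%N.
  have [s [bs <-]] : exists s, b < s /\ x s = x b.
    apply: (@filter_ex _ (b^'+)).
    near=> s; split; near: s; first exact: nbhs_right_gt.
    exact: path_eq_right.
  exact: A_gt.
exists b; split => //.
- by rewrite ereal_inf_EFin //; [exists a|exists t].
- rewrite ge_inf // ?andbT; last exact: infA.2.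
  rewrite lt_neqAle ab andbT; apply: contraTN xb => /eqP <-.
  by rewrite ltnn.
- by move=> s /andP[? ?]; exact: A_lt.
Unshelve. all: by end_near. Qed.

Lemma jump_timeS_le n (t : R) : (jump_time x n.+1 <= t%:E)%E ->
  exists a, [/\ jump_time x n = a%:E, 0 <= a <= t & x t <> x a].
Proof.
move=> nt; have [s [ns xs]] : exists s : R,
    (jump_time x n < s%:E)%E /\ x s <> x (fine (jump_time x n)).
  have : (jump_time x n.+1 < +oo)%E by rewrite (le_lt_trans nt) ?ltry.
  by move=> /ereal_inf_lt[_ [s ? _] _]; exists s.
have [a E] : exists a, jump_time x n = a%:E.
  have := jump_time_ge0 n.
  by case: (jump_time x n) ns => [a| |] // _ _; exists a.
have := jump_time_ge0 n; move: ns xs; rewrite E lte_fin lee_fin => as_ xs a0.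
have [b [nb /andP[ab _] xab _]] := jump_timeS a0 E (ltW as_) xs.
move: nt; rewrite nb lee_fin => bt.
exists a; split; [by []|by lra|].
have : (x b <= x t)%N by apply: x_nd; lra.
by move=> xbt e; move: xab; rewrite ltnNge -e xbt.
Qed.

(** Induction on the jumps. The levels strictly between two successive values are skipped, so over
    them [roll_index] stays at the same jump and counts its rolls. The bound on [n] shows that there
    are finitely many jumps before any time. *)
Lemma roll_index_jump n a : 0 <= a -> jump_time x n = a%:E ->
  [/\ (n <= x a)%N, roll_index (visited x) (x a) = (n, 0%N) &
   forall f : nat -> nat -> nat,
    (\sum_(l < n) \sum_(m < jump_size x l.+1) f l m =
     \sum_(u < x a)
       f (roll_index (visited x) u).1 (roll_index (visited x) u).2)%N].
Proof.
elim: n a => [|n IHn] b b0.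
  move=> [<-]; rewrite x0; split => // f.
  by rewrite !big_ord0.
move=> nb; have [a [na /andP[a0 ab] xba]] : exists a,
    [/\ jump_time x n = a%:E, 0 <= a <= b & x b <> x a].
  by apply: jump_timeS_le; rewrite nb.
have [nxa phia sumE] := IHn a a0 na.
have [b' [nb' /andP[ab' _] xab xE]] := jump_timeS a0 na ab xba.
move: nb' ab' xab xE; rewrite nb => -[<-] {}ab xab xE.
have visb : visited x (x b) by apply/asboolP; exists b.
have visN v : (x a < v < x b)%N -> visited x v = false.
  move=> /andP[av vb]; apply/asboolPn => -[s s0 xs].
  have [sa|as_] := leP s a; first by have := x_nd s0 sa; lia.
  have [bs|sb] := leP b s; first by have := x_nd b0 bs; lia.
  by have := xE s; rewrite (ltW as_) sb => /(_ isT); lia.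
have phiE m : (m < x b - x a)%N -> roll_index (visited x) (x a + m) = (n, m).
  elim: m => [|m IHm] mab; first by rewrite addn0.
  rewrite addnS /= visN; last by lia.
  by rewrite IHm //; lia.
have jsE : jump_size x n.+1 = (x b - x a)%N by rewrite /jump_size nb na.
split; first by lia.
- have xbE : x b = (x a + (x b - x a).-1).+1 by lia.
  by rewrite xbE /= -xbE visb phiE //; lia.
- move=> f; rewrite big_ord_recr /= sumE jsE -[in RHS](subnKC (ltnW xab)).
  rewrite big_split_ord /=; congr (_ + _)%N.
  by apply: eq_bigr => m _; rewrite phiE.
Qed.

Lemma sum_jumps_roll_index (f : nat -> nat -> nat) t : 0 <= t ->
  (\big[addn/0]_(n \in [set n | (jump_time x n.+1 <= t%:E)%E])
     \sum_(m < jump_size x n.+1) f n m =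
   \sum_(u < x t)
     f (roll_index (visited x) u).1 (roll_index (visited x) u).2)%N.
Proof.
move=> t0.
(* [N] is the last jump up to [t]. If there were none, every jump time would be at most [t], and
   jump number [(x t).+1] would already lie above level [x t]. *)
have [N [a [Na at_ xta]]] : exists N a,
    [/\ jump_time x N = a%:E, 0 <= a <= t & x t = x a].
  apply: contrapT => H.
  suff /(_ (x t).+1)[a [na /andP[a0 at_]]] : forall n, exists a,
      jump_time x n = a%:E /\ 0 <= a <= t.
    have [nxa _ _] := roll_index_jump a0 na.
    by have := x_nd a0 at_; lia.
  elim=> [|n [a [na /andP[a0 at_]]]]; first by exists 0; rewrite lexx.
  have xta : x t <> x a.
    by move=> e; apply: H; exists n, a; split => //; apply/andP.
  have [b [nb /andP[ab bt] _ _]] := jump_timeS a0 na at_ xta.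
  by exists b; split => //; rewrite bt andbT; lra.
have /andP[a0 ale] := at_.
(* Index [n] stands for jump [n + 1]; jump [N + 1] occurring by time [t] would contradict that [x t]
   is the value at jump [N]. *)
have -> : [set n | (jump_time x n.+1 <= t%:E)%E] = `I_N.
  have jt_nd m n : (m <= n)%N -> (jump_time x m <= jump_time x n)%E.
    elim: n => [|n IHn]; first by rewrite leqn0 => /eqP ->.
    rewrite leq_eqVlt => /predU1P[-> //|]; rewrite ltnS => /IHn /le_trans.
    by apply; apply/ereal_infP => _ [s /= [ns _] <-]; exact: ltW.
  apply/seteqP; split => n /=.
    rewrite ltnNge => nt; apply/negP => Nn.
    have : (jump_time x N.+1 <= t%:E)%E := le_trans (jt_nd N.+1 n.+1 Nn) nt.
    by move=> /jump_timeS_le[a']; rewrite Na => -[[<-]].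
  by move=> nN; apply: (le_trans (jt_nd _ _ nN)); rewrite Na lee_fin.
have [_ _ sumE] := roll_index_jump a0 Na.
by rewrite -fsbig_ord sumE xta.
Qed.

End Paths.

(** * Independence of nat-valued variables *)

Lemma events_of_preimage d (Omega : measurableType d) T (X : Omega -> T) B :
  events_of X (X @^-1` B).
Proof. by exists B => //; rewrite setTI. Qed.

Lemma sigma_genW d (Omega : measurableType d) T I (D : set I)
    (X : I -> Omega -> T) t B : D t -> sigma_gen D X (X t @^-1` B).
Proof.
move=> Dt; apply: sub_sigma_algebra; exists t => //.
exact: events_of_preimage.
Qed.

Lemma sigma_gen_sub d (Omega : measurableType d) T I (D : set I)
    (X : I -> Omega -> T) :
  (forall t, D t -> events_of (X t) `<=` measurable) ->
  sigma_gen D X `<=` measurable.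
Proof.
move=> mX; apply: smallest_sub; first exact: sigma_algebra_measurable.
by move=> A [t Dt]; exact: mX.
Qed.

Section SigmaGen.
Context d (Omega : measurableType d) (T I : Type) (D : set I).
Variable X : I -> Omega -> T.
Let F := sigma_gen D X.

Lemma sigma_genI A B : F A -> F B -> F (A `&` B).
Proof. exact: (@measurableI _ (g_sigma_algebraType _)). Qed.

Lemma sigma_genU A B : F A -> F B -> F (A `|` B).
Proof. exact: (@measurableU _ (g_sigma_algebraType _)). Qed.

Lemma sigma_genC A : F A -> F (~` A).
Proof. exact: (@measurableC _ (g_sigma_algebraType _)). Qed.

Lemma sigma_genT : F setT.
Proof. exact: (@measurableT _ (g_sigma_algebraType _)). Qed.

Lemma sigma_gen_bigcup (J : countType) (A : J -> set Omega) :
  (forall j, F (A j)) -> F (\bigcup_j A j).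
Proof.
move=> FA; exact: (@countable_bigcupT_measurable _ (g_sigma_algebraType _)).
Qed.

Lemma sigma_gen_forall_lt K (A : nat -> set Omega) :
  (forall j, (j < K)%N -> F (A j)) ->
  F [set w | forall j, (j < K)%N -> A j w].
Proof.
elim: K => [|K IHK] FA.
  rewrite (_ : [set _ | _] = setT); first exact: sigma_genT.
  by apply/seteqP; split.
rewrite (_ : [set _ | _] = [set w | forall j, (j < K)%N -> A j w] `&` A K).
  by apply: sigma_genI; [apply: IHK => j jK; apply: FA; lia|exact: FA].
apply/seteqP; split => w /= H.
  by split => [j jK|]; apply: H; lia.
move=> j; rewrite ltnS leq_eqVlt => /predU1P[->|]; first exact: H.2.
exact: H.1.
Qed.

End SigmaGen.

(** * Summing out auxiliary variables; independence along an injective enumeration *)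

Section Mixing.
Context (R : realType) d (Omega : measurableType d) (P : probability Omega R).

Lemma probabilityU (A B : set Omega) : measurable A -> measurable B ->
  A `&` B = set0 -> P (A `|` B) = (P A + P B)%E.
Proof. by move=> mA mB AB0; exact: measureU. Qed.

Lemma probability_sum_preimage (Y : Omega -> nat) (E : set Omega) :
  (forall a, measurable (Y @^-1` [set a])) -> measurable E ->
  P E = (\sum_(a <oo) P (E `&` Y @^-1` [set a]))%E.
Proof.
move=> mY mE.
have {1}-> : E = \bigcup_a (E `&` Y @^-1` [set a]).
  by apply/seteqP; split => [w Ew|w [a _ []//]]; exists (Y w).
rewrite measure_bigcup //=; first exact/eq_eseriesl/in_setT.
- by move=> a _; exact: measurableI.
- by move=> a b _ _ [w [[_ <-] [_ <-]]].
Qed.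

Lemma probability_forall_mixing (Y : nat -> Omega -> nat)
    (H : nat -> set Omega) (f : nat -> nat -> R) (g : nat -> R) K :
  (forall j a, measurable (Y j @^-1` [set a])) ->
  (forall j, measurable (H j)) ->
  (forall j a, 0 <= f j a) ->
  (forall j, (\sum_(a <oo) (f j a)%:E = (g j)%:E)%E) ->
  (forall a : nat -> nat,
    P [set w | forall j, (j < K)%N -> Y j w = a j /\ H j w] =
      (\prod_(j < K) f j (a j))%:E) ->
  P [set w | forall j, (j < K)%N -> H j w] = (\prod_(j < K) g j)%:E.
Proof.
move=> mY mH f0 fg PE.
have mforall (A : nat -> set Omega) n : (forall j, measurable (A j)) ->
    measurable [set w | forall j, (j < n)%N -> A j w].
  move=> mA; rewrite (_ : [set _ | _] = \bigcap_(j in `I_n) A j) //.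
  by apply: bigcap_measurableType => j _; exact: mA.
(* Sum out the values of the Y j one index at a time, from the last one. *)
suff : forall l a, (l <= K)%N ->
    P [set w | forall j, (j < K)%N -> ((j < l)%N -> Y j w = a j) /\ H j w] =
    ((\prod_(j < l) f j (a j)) * \prod_(l <= j < K) g j)%:E.
  move=> /(_ 0%N (fun=> 0%N) isT); rewrite big_ord0 mul1r big_mkord => <-.
  congr (P _); apply/seteqP; split => w /= Hw j jK; last by have [] := Hw j jK.
  by split => //; exact: Hw.
move=> l a lK; rewrite -(subKn lK); move: (K - l)%N (leq_subr l K) => {lK l} n.
elim: n a => [|n IHn] a nK.
  rewrite subn0 big_geq // mulr1 -PE; congr (P _).
  apply/seteqP; split => w /= Hw j jK; have [H1 H2] := Hw j jK; split => //.
  exact: H1.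
set l := (K - n.+1)%N.
have lS : (K - n)%N = l.+1 by rewrite /l; lia.
rewrite lS in IHn.
rewrite (probability_sum_preimage (mY l)); last first.
  apply: mforall => j; apply: measurableI; last exact: mH.
  have [jl|lj] := ltnP j l.
    rewrite (_ : (fun w => _) = Y j @^-1` [set a j]); first exact: mY.
    by apply/seteqP; split => w /=; [exact|move=> ->].
  by rewrite (_ : (fun w => _) = setT) //; apply/seteqP; split.
pose a' b j := if j == l then b else a j.
transitivity (\sum_(b <oo)
    (((\prod_(j < l) f j (a j)) * \prod_(l.+1 <= j < K) g j)%:E *
     (f l b)%:E))%E.
  apply: eq_eseriesr => b _.
  have := IHn (a' b) (ltnW nK); rewrite big_ord_recr /= /a' eqxx.
  under eq_bigr => j _ do rewrite (ltn_eqF (ltn_ord j)).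
  rewrite -EFinM mulrAC => <-; congr (P _); apply/seteqP; split => w /=.
    move=> [Hw Yb] j jK; have [H1 H2] := Hw j jK; split => //.
    case: eqP => [-> //|jl] j1; apply: H1; lia.
  move=> Hw; split => [j jK|].
    have [H1 H2] := Hw j jK; split => // jl.
    by rewrite H1 ?(ltn_eqF jl) //; exact: ltnW.
  have lK : (l < K)%N by rewrite /l; lia.
  by have [-> //] := Hw l lK; rewrite eqxx.
rewrite nneseriesZl ?fg; last by move=> b _; rewrite lee_fin.
rewrite -EFinM -mulrA; congr (_ * _)%:E.
by rewrite [in RHS]big_ltn ?(mulrC (g l)) // /l; lia.
Qed.

(** Injectivity makes [phi] list distinct members of the family, so the product over a finite set of
    indices becomes a product over [u]. The position in the list [s] recovers [u] from [phi u]. *)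
Lemma mutually_independent_inj (T : Type) (I : choiceType)
    (X : I -> Omega -> T) (phi : nat -> I) (U : nat) (B : nat -> set T) :
  mutually_independent P X -> injective phi ->
  P [set w | forall u, (u < U)%N -> B u (X (phi u) w)] =
    (\prod_(u < U) P (X (phi u) @^-1` B u))%E.
Proof.
move=> indX phi_inj; pose s := map phi (iota 0 U).
have idx u : (u < U)%N -> index (phi u) s = u.
  move=> uU; rewrite index_map // -[u in index u](@nth_iota 0 0 U) //.
  by rewrite index_uniq ?iota_uniq ?size_iota.
have := indX [fset x in s]%fset (fun y => X y @^-1` B (index y s)).
move=> /(_ (fun i _ => events_of_preimage _ _)) indXs.
transitivity (P (\bigcap_(i in [set` [fset x in s]%fset])
    X i @^-1` B (index i s))).
  congr (P _); apply/seteqP; split => w /= Hw.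
    move=> i /=; rewrite inE => /mapP[u]; rewrite mem_iota => uU ->.
    by rewrite /= idx; [apply: Hw|]; lia.
  move=> u uU; have := Hw (phi u); rewrite /= idx //; apply.
  by rewrite inE map_f // mem_iota.
rewrite {}indXs (perm_big s) /=; last first.
  apply: uniq_perm => //; first by rewrite map_inj_uniq ?iota_uniq.
  by move=> x; rewrite inE.
rewrite big_map -[in LHS](subn0 U) big_mkord; apply: eq_bigr => u _.
by rewrite idx.
Qed.

End Mixing.

(** * The order of the rolls *)

Section Rolls.
Context (R : realType) (d : measure_display) (Omega : measurableType d).
Variable P : probability Omega R.
Context (q : nat) (p : 'I_q -> R) (M : R -> Omega -> nat).
Context (xi : nat -> nat -> Omega -> 'I_q) (i : 'I_q).
Hypothesis M_cp : counting_process M.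
Hypothesis M0 : forall w, M 0 w = 0%N.
Hypothesis M_rolls : die_rolls P p M xi.

Let FM := sigma_gen [set t : R | 0 <= t] M.

Let FM_measurable : FM `<=` measurable.
Proof.
apply: sigma_gen_sub => t t0 A [B _ <-].
exact: (cp_measurable M_cp t0).
Qed.

(** By right continuity a visited level is held for a while, hence is taken at a rational time; the
    uncountable union over times becomes a countable one. *)
Lemma sigma_gen_visited v : FM [set w | visited (M ^~ w) v].
Proof.
rewrite (_ : [set _ | _] = \bigcup_(r : rat)
    (if 0 <= ratr r :> R then M (ratr r) @^-1` [set v] else set0)).
  apply: sigma_gen_bigcup => r; case: ifP => r0; first exact: sigma_genW.
  by rewrite -setCT; apply: sigma_genC; exact: sigma_genT.
apply/seteqP; split => w /=; last first.
  move=> [r _]; case: ifP => //= r0 Mr; apply/asboolP.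
  by exists (ratr r).
move=> /asboolP[s s0 sv].
have [e /= e0 He] := path_eq_right (@cp_right_continuous _ _ _ _ M_cp w) s0.
have [r] := @rat_in_itvoo R s (s + e) ltac:(lra).
rewrite in_itv /= => /andP[sr re]; exists r => //=.
rewrite ifT; last by lra.
by rewrite -sv; apply: He => //=; rewrite distrC gtr0_norm; lra.
Qed.

Definition roll_at (w : Omega) (u : nat) : nat * nat :=
  roll_index (visited (M ^~ w)) u.

(** Leaving [Q] arbitrary lets the induction pull it back along the two branches of [roll_index]. *)
Lemma sigma_gen_roll_at u (Q : set (nat * nat)) : FM [set w | Q (roll_at w u)].
Proof.
elim: u Q => [|u IHu] Q.
  have [Q0|Q0] := pselect (Q (0, 0)%N).
    rewrite (_ : [set _ | _] = setT); first exact: sigma_genT.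
    by apply/seteqP; split.
  rewrite (_ : [set _ | _] = ~` setT).
    by apply: sigma_genC; exact: sigma_genT.
  by rewrite setCT; apply/seteqP; split.
have FV := sigma_gen_visited u.+1.
rewrite (_ : [set _ | _] =
  ([set w | visited (M ^~ w) u.+1] `&`
     [set w | [set nm : nat * nat | Q (nm.1.+1, 0%N)] (roll_at w u)]) `|`
  (~` [set w | visited (M ^~ w) u.+1] `&`
     [set w | [set nm : nat * nat | Q (nm.1, nm.2.+1)] (roll_at w u)])).
  apply: sigma_genU; apply: sigma_genI; [exact: FV|exact: IHu| |exact: IHu].
  exact: sigma_genC.
apply/seteqP; split => w /=; rewrite /roll_at /=.
  by case: ifP => V Qw; [left|right].
by case: ifP => V [[]|[]].
Qed.

Definition success (w : Omega) (u : nat) : bool :=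
  xi (roll_at w u).1 (roll_at w u).2 w == i.

(** After this identity jump times are no longer needed: the split component depends on the path
    only through [M t] and the reordered outcomes. *)
Lemma split_componentE t w : 0 <= t ->
  split_component M xi i t w = (\sum_(u < M t w) success w u)%N.
Proof.
move=> t0; have nd := @cp_nondecreasing _ _ _ _ M_cp w.
by have := sum_jumps_roll_index nd (@cp_right_continuous _ _ _ _ M_cp w) (M0 w)
  (fun n m => xi n m w == i : nat) t0.
Qed.

Lemma measurable_roll n m (B : set 'I_q) : measurable (xi n m @^-1` B).
Proof. by apply: (rolls_measurable M_rolls); exact: events_of_preimage. Qed.

Lemma measurable_success u b : measurable [set w | success w u = b].
Proof.
rewrite (_ : [set _ | _] = \bigcup_(nm : nat * nat)
    ([set w | [set nm] (roll_at w u)] `&`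
     xi nm.1 nm.2 @^-1` [set f | (f == i) = b])).
  apply: countable_bigcupT_measurable => // nm; apply: measurableI.
    by apply: FM_measurable; exact: (sigma_gen_roll_at u [set nm]).
  exact: measurable_roll.
apply/seteqP; split => w /=; rewrite /success.
  by move=> wb; exists (roll_at w u).
by move=> [nm _ [/= -> ]].
Qed.

Definition bern (b : bool) : R := if b then p i else 1 - p i.

Lemma probability_face n m b :
  P (xi n m @^-1` [set f | (f == i) = b]) = (bern b)%:E.
Proof.
have E1 : xi n m @^-1` [set f | (f == i) = true] = [set w | xi n m w = i].
  by apply/seteqP; split => w /= /eqP.
case: b; first by rewrite E1 (rolls_law M_rolls).
rewrite (_ : _ @^-1` _ = ~` [set w | xi n m w = i]).
  rewrite probability_setC ?(rolls_law M_rolls) //.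
  exact: (measurable_roll n m [set i]).
by apply/seteqP; split => w /=; [move=> /negbT/eqP|move=> /eqP/negbTE].
Qed.

Lemma probability_success_law E U (c : nat -> bool) : FM E ->
  P (E `&` [set w | forall u, (u < U)%N -> success w u = c u]) =
  (P E * (\prod_(u < U) bern (c u))%:E)%E.
Proof.
(* Once the levels visited below U are known, the rolls used below level U are
   distinct deterministic ones; the visited levels are fixed one at a time. *)
move=> FE; set Z := [set w | _].
have mZ : measurable Z.
  rewrite (_ : Z = \bigcap_(u in `I_U) [set w | success w u = c u]) //.
  by apply: bigcap_measurableType => u _; exact: measurable_success.
(* [D] is an event on which the visits below level [l] are prescribed by [b]; the induction descends
   from [l = U] to the unrestricted case [l = 0]. *)
suff : forall l b D, (l <= U)%N -> FM D ->
    (forall w v, D w -> (v < l)%N -> visited (M ^~ w) v = b v) ->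
    P (D `&` Z) = (P D * (\prod_(u < U) bern (c u))%:E)%E.
  by move=> /(_ 0%N xpredT E isT FE); exact.
move=> l b D lU; rewrite -(subKn lU).
move: (U - l)%N (leq_subr l U) => {lU l} n.
elim: n b D => [|n IHn] b D nU FD Db.
  rewrite subn0 in Db.
  (* With all visits below [U] prescribed, the rolls are the deterministic ones [phi u]: [D] splits
     off by independence of [M], and the rolls separate because [phi] is injective. *)
  pose phi := roll_index b.
  pose B u : set 'I_q := [set f | (f == i) = c u].
  rewrite (_ : D `&` Z = D `&`
      [set w | forall u, (u < U)%N -> B u (xi (phi u).1 (phi u).2 w)]).
    rewrite (rolls_independent_process M_rolls) //; last first.
      apply: (@sigma_gen_forall_lt _ _ _ _ _ _ _
        (fun u => xi (phi u).1 (phi u).2 @^-1` B u)) => u uU.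
      exact: (@sigma_genW _ _ _ _ setT (fun nm : nat * nat => xi nm.1 nm.2)
        (phi u)).
    have := mutually_independent_inj U B (rolls_independent M_rolls)
      (@roll_index_inj b).
    move=> ->; congr (_ * _)%E.
    rewrite -prodEFin; apply: eq_bigr => u _.
    exact: probability_face.
  have phiE w u : D w -> (u < U)%N -> roll_at w u = phi u.
    by move=> Dw uU; apply: eq_roll_index => v vu; apply: Db => //; lia.
  apply/seteqP; split => w [Dw /= Zw]; split => // u uU.
    by rewrite /B /= -(phiE w) //; exact: Zw.
  by rewrite /success phiE //; exact: Zw.
set m := (U - n.+1)%N.
have mS : (U - n)%N = m.+1 by rewrite /m; lia.
rewrite mS in IHn.
pose V := [set w | visited (M ^~ w) m].
have FV : FM V by exact: sigma_gen_visited.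
have mV := FM_measurable FV; have mD := FM_measurable FD.
have step b' A : FM A -> A `<=` D ->
    (forall w, A w -> visited (M ^~ w) m = b') ->
    P (A `&` Z) = (P A * (\prod_(u < U) bern (c u))%:E)%E.
  move=> FA AD Ab; apply: (IHn (fun v => if v == m then b' else b v)) => //.
    exact: ltnW.
  move=> w v Aw vm; case: eqP => [->|vm']; first exact: Ab.
  by apply: Db; [exact: AD|rewrite -/m; lia].
have PV A : measurable A -> P A = (P (A `&` ~` V) + P (A `&` V))%E.
  by move=> mA; rewrite -setDE; exact: measureDI.
rewrite (PV (D `&` Z)) ?(PV D) //; last exact: measurableI.
rewrite !(setIAC D Z) (step false) ?(step true).
- rewrite -ge0_muleDl //; exact: measure_ge0.
- exact: sigma_genI.
- exact: subIsetl.
- by move=> w [].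
- by apply: sigma_genI => //; exact: sigma_genC.
- exact: subIsetl.
- by move=> w [_ /negP/negbTE].
Qed.

Lemma prod_bernS n (c : nat -> bool) :
  \prod_(u < n.+1) bern (c u) = bern (c 0%N) * \prod_(u < n) bern (c u.+1).
Proof. by rewrite big_ord_recl. Qed.

(** [H] is treated as information from the rolls before [U]: jointly with any event of [M], it
    leaves the outcomes from [U] on i.i.d. This product rule stands in for a filtration of the
    reordered rolls. *)
Definition indep_from (U : nat) (H : set Omega) : Prop :=
  measurable H /\ forall E n (c : nat -> bool), FM E ->
  P (E `&` H `&` [set w | forall u, (u < n)%N -> success w (U + u) = c u]) =
  (P (E `&` H) * (\prod_(u < n) bern (c u))%:E)%E.

Lemma indep_from0 : indep_from 0 setT.
Proof.
split=> [|E n c FE]; first exact: measurableT.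
by rewrite setIT probability_success_law.
Qed.

Lemma indep_from_set0 U : indep_from U set0.
Proof. by split => // E n c FE; rewrite setI0 set0I measure0 mul0e. Qed.

Lemma indep_fromU U H1 H2 : indep_from U H1 -> indep_from U H2 ->
  H1 `&` H2 = set0 -> indep_from U (H1 `|` H2).
Proof.
move=> [mH1 i1] [mH2 i2] H12; split=> [|E n c FE]; first exact: measurableU.
have mE := FM_measurable FE.
set Z := [set w | _].
have mZ : measurable Z.
  rewrite (_ : Z = \bigcap_(u in `I_n) [set w | success w (U + u) = c u]) //.
  by apply: bigcap_measurableType => u _; exact: measurable_success.
rewrite !setIUr setIUl !probabilityU ?i1 ?i2 //.
- by rewrite -ge0_muleDl.
- exact: measurableI.
- exact: measurableI.
- by rewrite setIACA H12 setI0.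
- by apply: measurableI => //; exact: measurableI.
- by apply: measurableI => //; exact: measurableI.
- by rewrite setIACA (setIACA E) H12 setI0 set0I.
Qed.

Lemma indep_fromS U H b : indep_from U H ->
  indep_from U.+1 (H `&` [set w | success w U = b]) /\
  forall E, FM E ->
    P (E `&` (H `&` [set w | success w U = b])) =
    (P (E `&` H) * (bern b)%:E)%E.
Proof.
move=> [mH iH].
have law E : FM E -> P (E `&` (H `&` [set w | success w U = b])) =
    (P (E `&` H) * (bern b)%:E)%E.
  move=> FE; have := iH E 1%N (fun=> b) FE; rewrite big_ord1 => <-.
  rewrite setIA; congr (P (_ `&` _)); apply/seteqP; split => w /= Hw.
    by move=> [|//] _; rewrite addn0.
  by have := Hw 0%N isT; rewrite addn0.
split=> //; split=> [|E n c FE].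
  by apply: measurableI => //; exact: measurable_success.
rewrite law // -muleA -EFinM.
(* The observed outcome [b] is put in front of the pattern [c], giving a block of length [n + 1]
   that starts at [U]. *)
pose c' u := if u is v.+1 then c v else b.
rewrite -(prod_bernS n c') -(iH E n.+1 c' FE) setIA -setIA.
congr (P (_ `&` _)); apply/seteqP; split => w /=.
  by move=> [Hb Hw] [_|u un]; rewrite ?addn0 // addnS -addSn; exact: Hw.
move=> Hw; split=> [|u un]; first by have := Hw 0%N isT; rewrite addn0.
by have := Hw u.+1 un; rewrite addnS addSn.
Qed.

Definition successes (U n : nat) (w : Omega) : nat :=
  (\sum_(u < n) success w (U + u))%N.

Lemma successesS U n w : successes U n.+1 w = (success w U + successes U.+1 n w)%N.
Proof.
rewrite /successes big_ord_recl /= addn0; congr (_ + _)%N.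
by apply: eq_bigr => u _; rewrite /= /bump /= addnS addSn.
Qed.

(** Conditioning on the outcome of roll [U] gives exactly the recursion of [thin]: a success shifts
    [B], a failure keeps it. The start [U], the event [H] and the set [B] all vary in the
    induction. *)
Lemma indep_from_successes U n H B : indep_from U H ->
  indep_from (U + n) (H `&` [set w | B (successes U n w)]) /\
  forall E, FM E ->
    P (E `&` (H `&` [set w | B (successes U n w)])) =
    (P (E `&` H) * (thin (p i) n B)%:E)%E.
Proof.
elim: n U H B => [|n IHn] U H B iH.
  have E0 w : successes U 0 w = 0%N by rewrite /successes big_ord0.
  rewrite addn0 /=; have [B0|B0] := pselect (B 0%N).
    rewrite (_ : [set w | _] = setT); last first.
      by apply/seteqP; split => w //= _; rewrite E0.
    by rewrite setIT indicE mem_set //; split => // E _; rewrite mule1.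
  rewrite (_ : [set w | _] = set0); last first.
    by apply/seteqP; split => w //=; rewrite E0.
  rewrite setI0 indicE memNset //; split; first exact: indep_from_set0.
  by move=> E _; rewrite setI0 measure0 mule0.
have [iH1 law1] := indep_fromS true iH.
have [iH0 law0] := indep_fromS false iH.
have [iS1 lawS1] := IHn _ _ [set s | B s.+1] iH1.
have [iS0 lawS0] := IHn _ _ B iH0.
set S1 := _ `&` _ in iS1 lawS1; set S0 := _ `&` _ in iS0 lawS0.
have -> : H `&` [set w | B (successes U n.+1 w)] = S1 `|` S0.
  apply/seteqP; split => w /=.
    move=> [Hw]; rewrite successesS.
    by case E : (success w U) => Bw; [left|right].
  by move=> [[[Hw /= s] Bw]|[[Hw /= s] Bw]]; split; rewrite ?successesS ?s.
have S10 : S1 `&` S0 = set0.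
  apply/seteqP; split => w // [[[_ /= s1] _] [[_ /= s0] _]].
  by rewrite s1 in s0.
split; first by rewrite addnS -addSn; exact: indep_fromU.
move=> E FE; have mE := FM_measurable FE.
rewrite setIUr probabilityU ?lawS1 ?lawS0 ?law1 ?law0 //.
- rewrite -!muleA -!EFinM -muleDr //.
  by apply: fin_num_measure; apply: measurableI => //; case: iH.
- by apply: measurableI => //; case: iS1.
- by apply: measurableI => //; case: iS0.
- by rewrite setIACA S10 setI0.
Qed.

End Rolls.

(** * Increments of the split process *)

Section ThinnedLaw.
Context (R : realType) (d : measure_display) (Omega : measurableType d).
Variables (P : probability Omega R) (p : R).
Hypothesis p01 : 0 <= p <= 1.

(** The binomial law mixed over its number of trials, distributed as [Y]. Taking [fine] loses
    nothing, as the series is bounded by the total mass of [Y]. *)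
Definition thinned_law (Y : Omega -> nat) (B : set nat) : R :=
  fine (\sum_(a <oo) (fine (P (Y @^-1` [set a])) * thin p a B)%:E)%E.

Variable Y : Omega -> nat.
Hypothesis mY : forall B, measurable (Y @^-1` B).

Lemma thinned_term_ge0 a B : 0 <= fine (P (Y @^-1` [set a])) * thin p a B.
Proof. by rewrite mulr_ge0 ?thin_ge0 // fine_ge0. Qed.

Lemma sum_law_eq1 : (\sum_(a <oo) (fine (P (Y @^-1` [set a])))%:E = 1)%E.
Proof.
rewrite -(@probability_setT _ _ _ P) (probability_sum_preimage P (Y := Y)) //.
apply: eq_eseriesr => a _; rewrite setTI fineK //.
exact: fin_num_measure.
Qed.

Lemma thinned_lawE B :
  (\sum_(a <oo) (fine (P (Y @^-1` [set a])) * thin p a B)%:E =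
   (thinned_law Y B)%:E)%E.
Proof.
rewrite fineK // ge0_fin_numE; last first.
  by apply: nneseries_ge0 => a _ _; rewrite lee_fin thinned_term_ge0.
apply: (@le_lt_trans _ _ 1%E); last exact: ltry.
rewrite -sum_law_eq1; apply: lee_nneseries => a _.
  by rewrite lee_fin thinned_term_ge0.
by rewrite lee_fin ler_piMr ?thin_le1 // fine_ge0.
Qed.

Lemma thinned_law_setT : thinned_law Y setT = 1.
Proof.
rewrite /thinned_law; under eq_eseriesr => a _ do rewrite thin_setT mulr1.
by rewrite sum_law_eq1.
Qed.

End ThinnedLaw.

Section Increments.
Context (R : realType) (d : measure_display) (Omega : measurableType d).

Lemma sigma_gen_increment (M : R -> Omega -> nat) (s t : R) B : 0 <= s -> 0 <= t ->
  sigma_gen [set t : R | 0 <= t] M (increment M s t @^-1` B).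
Proof.
move=> s0 t0; rewrite (_ : _ @^-1` _ = \bigcup_(m : nat)
    (M s @^-1` [set m] `&` M t @^-1` [set n | B (n - m)%N])).
  by apply: sigma_gen_bigcup => m; apply: sigma_genI; exact: sigma_genW.
apply/seteqP; split => w /=; first by exists (M s w).
by move=> [_ _ [/= <-]].
Qed.

Lemma measurable_increment (M : R -> Omega -> nat) (s t : R) B :
  (forall (t : R) B, 0 <= t -> measurable (M t @^-1` B)) ->
  0 <= s -> 0 <= t -> measurable (increment M s t @^-1` B).
Proof.
move=> mM s0 t0; have := @sigma_gen_increment M s t B s0 t0; apply: sigma_gen_sub.
by move=> r r0 A [C _ <-]; rewrite setTI; exact: mM.
Qed.

Lemma counting_measurable (M : R -> Omega -> nat) (t : R) B : counting_process M ->
  0 <= t -> measurable (M t @^-1` B).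
Proof.
by move=> cM t0; rewrite -[X in measurable X]setTI; exact: cp_measurable.
Qed.

End Increments.

(** * Joint law of the increments of a split component *)

Section SplitIncrements.
Context (R : realType) (d : measure_display) (Omega : measurableType d).
Variable P : probability Omega R.
Context (q : nat) (p : 'I_q -> R) (M : R -> Omega -> nat).
Context (xi : nat -> nat -> Omega -> 'I_q) (i : 'I_q).
Hypothesis M_cp : counting_process M.
Hypothesis M0 : forall w, M 0 w = 0%N.
Hypothesis M_rolls : die_rolls P p M xi.
Hypothesis M_indep : independent_increments P M.
Hypothesis pi01 : 0 <= p i <= 1.

Let X := split_component M xi i.

Lemma measurable_split t B : 0 <= t -> measurable (X t @^-1` B).
Proof.
move=> t0; rewrite (_ : _ @^-1` _ = \bigcup_(n : nat)
    (M t @^-1` [set n] `&` (setT `&` [set w | B (successes M xi i 0 n w)]))).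
  apply: bigcupT_measurable => n; apply: measurableI.
    exact: counting_measurable.
  have iT := indep_from0 i M_cp M_rolls.
  by have [[]] := indep_from_successes M_cp M_rolls n B iT.
apply/seteqP; split => w /=.
  by rewrite /X (split_componentE xi i M_cp M0) //; exists (M t w).
move=> [_ _ [/= <- [_]]].
by rewrite /X (split_componentE xi i M_cp M0).
Qed.

(** The rolls consumed up to [s] are a prefix of those consumed up to [t], so only the block between
    the levels [M s] and [M t] counts. *)
Lemma increment_splitE s t w : 0 <= s -> s <= t ->
  increment X s t w = successes M xi i (M s w) (increment M s t w) w.
Proof.
move=> s0 st; have t0 := le_trans s0 st.
rewrite {1}/increment /X !(split_componentE xi i M_cp M0) //.
have Mst := @cp_nondecreasing _ _ _ _ M_cp w s t s0 st.
rewrite -[in X in (X - _)%N](subnKC Mst) big_split_ord /= addKn.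
by apply: eq_bigr.
Qed.

Section Times.
Variable t : nat -> R.
Hypothesis t0 : t 0%N = 0.
Hypothesis t_nd : nondecreasing_seq t.

Let t_ge0 j : 0 <= t j. Proof. by rewrite -t0 t_nd. Qed.
Let tS j : t j <= t j.+1. Proof. exact: t_nd. Qed.

Let D j := increment M (t j) (t j.+1).

(** Since the times start at 0, where [M] vanishes, the increments determine the levels. Other
    starting times are handled below by prepending 0. *)
Lemma level_eq_sum (a : nat -> nat) K w :
  (forall j, (j < K)%N -> D j w = a j) ->
  forall j, (j <= K)%N -> M (t j) w = (\sum_(l < j) a l)%N.
Proof.
move=> Da; elim=> [|j IHj] jK; first by rewrite t0 M0 big_ord0.
rewrite big_ord_recr /= -IHj ?(ltnW jK) // -Da //.
by rewrite subnKC //; exact: cp_nondecreasing.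
Qed.

(** Once the increments of [M] are fixed to [a], the increments of [X] count successes in
    consecutive deterministic blocks of rolls, which start at the partial sums [A j] and have
    lengths [a j]. *)
Lemma probability_increments_split (a : nat -> nat) (B : nat -> set nat) K :
  P [set w | forall j, (j < K)%N ->
       D j w = a j /\ B j (increment X (t j) (t j.+1) w)] =
  (\prod_(j < K)
     (fine (P (D j @^-1` [set a j])) * thin (p i) (a j) (B j)))%:E.
Proof.
pose A j := (\sum_(l < j) a l)%N.
pose E := [set w | forall j, (j < K)%N -> [set a j] (D j w)].
pose H k := [set w | forall j, (j < k)%N ->
  B j (successes M xi i (A j) (a j) w)].
have FE : sigma_gen [set t : R | 0 <= t] M E.
  apply: (@sigma_gen_forall_lt _ _ _ _ _ _ _ (fun j => D j @^-1` [set a j])).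
  by move=> j _; exact: sigma_gen_increment.
(* The blocks are absorbed one after another, each contributing one binomial factor. *)
have [_ lawH] : indep_from P p M xi i (A K) (H K) /\
    (forall E, sigma_gen [set t : R | 0 <= t] M E ->
      P (E `&` H K) = (P E * (\prod_(j < K) thin (p i) (a j) (B j))%:E)%E).
  elim: K {E FE} => [|k [iH lawH]].
    rewrite (_ : H 0%N = setT); last by apply/seteqP; split.
    rewrite /A big_ord0; split; first exact: indep_from0.
    by move=> E _; rewrite setIT big_ord0 mule1.
  have [iHS lawHS] := indep_from_successes M_cp M_rolls (a k) (B k) iH.
  have -> : H k.+1 =
      H k `&` [set w | B k (successes M xi i (A k) (a k) w)].
    apply/seteqP; split => w /= Hw.
      by split => [j jk|]; apply: Hw; lia.
    move=> j; rewrite ltnS leq_eqVlt => /predU1P[->|]; first exact: Hw.2.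
    exact: Hw.1.
  split; first by rewrite /A big_ord_recr.
  by move=> E FE; rewrite lawHS // lawH // -muleA -EFinM big_ord_recr.
transitivity (P (E `&` H K)).
  congr (P _); apply/seteqP; split => w /=.
    move=> Hw; have Dw j : (j < K)%N -> D j w = a j by move=> /Hw[].
    split => // j jK; have [<-] := Hw j jK.
    by rewrite increment_splitE // (level_eq_sum Dw) //; exact: ltnW.
  move=> [Dw Hw] j jK; split; first exact: Dw.
  rewrite increment_splitE // (level_eq_sum Dw) ?(ltnW jK) //.
  by rewrite -/(D j w) Dw //; exact: Hw.
rewrite lawH // big_split /= EFinM; congr (_ * _)%E.
rewrite (mutually_independent_inj K (fun j => [set a j]) (M_indep _ t_nd)) //.
rewrite -prodEFin; apply: eq_bigr => j _; rewrite fineK //.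
apply: fin_num_measure; apply: measurable_increment => // s C s0.
exact: counting_measurable.
Qed.

Lemma probability_split_increments (B : nat -> set nat) K :
  P [set w | forall j, (j < K)%N -> B j (increment X (t j) (t j.+1) w)] =
  (\prod_(j < K) thinned_law P (p i) (D j) (B j))%:E.
Proof.
have mD j C : measurable (D j @^-1` C).
  apply: measurable_increment => // s ? s0; exact: counting_measurable.
pose f j a := fine (P (D j @^-1` [set a])) * thin (p i) a (B j).
pose H j := increment X (t j) (t j.+1) @^-1` B j.
apply: (@probability_forall_mixing _ _ _ P D H f
  (fun j => thinned_law P (p i) (D j) (B j)) K).
- by move=> j a; exact: mD.
- by move=> j; apply: measurable_increment => //; exact: measurable_split.
- by move=> j a; exact: thinned_term_ge0.
- by move=> j; exact: thinned_lawE.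
- by move=> a; exact: probability_increments_split.
Qed.

End Times.

Lemma split_increment_law s t B : 0 <= s -> s <= t ->
  P (increment X s t @^-1` B) =
  (thinned_law P (p i) (increment M s t) B)%:E.
Proof.
(* The times are 0, [s], then [t] forever; no constraint is put on the increment from 0 to [s]. *)
move=> s0 st; pose r n := if n is n'.+1 then if n' is _.+1 then t else s else 0.
have r_nd : nondecreasing_seq r.
  by apply/nondecreasing_seqP => -[|[|n]] //=.
have := @probability_split_increments r erefl r_nd
  (fun j => if j is 0%N then setT else B) 2.
rewrite !big_ord_recr big_ord0 /= mul1r thinned_law_setT ?mul1r => [<-|C].
  congr (P _); apply/seteqP; split => w /= Bw; last exact: (Bw 1%N).
  by move=> [|[|]].
apply: measurable_increment => // u A u0; exact: counting_measurable.
Qed.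

Lemma split_independent_increments : independent_increments P X.
Proof.
move=> t t0 t_nd J A AJ.
have mD s s' : 0 <= s -> 0 <= s' -> forall C,
    measurable (increment M s s' @^-1` C).
  move=> ? ? C; apply: measurable_increment => // u ? u0.
  exact: counting_measurable.
have t_ge0 n : 0 <= t n by apply: le_trans t0 _; exact: t_nd.
(* Time 0 is prepended, which shifts every increment by one index. *)
pose r n := if n is n'.+1 then t n' else 0.
have r_nd : nondecreasing_seq r.
  by apply/nondecreasing_seqP => -[|n] /=; [|exact: t_nd].
pose Y n := increment X (t n) (t n.+1).
(* Each [A n] is a preimage under [Y n], so it is recovered from its image. The first increment and
   the indices outside [J] get the full set, whose factor is 1. *)
pose B n : set nat := if n is n'.+1 then
  (if n' \in J then Y n' @` A n' else setT) else setT.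
have AE n w : n \in J -> A n w <-> (Y n @` A n) (Y n w).
  move=> nJ; split => [Aw|]; first by exists w.
  have [C _] := AJ n nJ; rewrite setTI => <- [w' /=]; rewrite -/(Y n) => Cw'.
  by rewrite /preimage /= => <-.
pose N := (\max_(n <- J) n).+1.
have JN n : n \in J -> (n < N)%N.
  by move=> nJ; rewrite ltnS (big_rem n) //= leq_maxl.
have := @probability_split_increments r erefl r_nd B N.+1.
rewrite big_ord_recl thinned_law_setT ?mul1r; last exact: mD.
move=> PB; transitivity (P [set w | forall j, (j < N.+1)%N ->
    B j (increment X (r j) (r j.+1) w)]).
  congr (P _); apply/seteqP; split => w /= Aw.
    move=> [|n] //= nN; case: ifPn => // nJ; apply/AE => //; exact: Aw.
  move=> n nJ; apply/AE => //; have := Aw n.+1 (JN n nJ).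
  by rewrite /= nJ.
rewrite {}PB -prodEFin.
transitivity (\prod_(0 <= n < N | n \in J) P (A n))%E; last first.
  rewrite /index_iota subn0 -big_filter; apply: perm_big; apply: uniq_perm.
  - exact/filter_uniq/iota_uniq.
  - exact: fset_uniq.
  - move=> n; rewrite mem_filter mem_iota /=; apply/andP/idP => [[]//|nJ].
    by split => //; rewrite add0n; exact: JN.
rewrite big_mkord [RHS]big_mkcond; apply: eq_bigr => n _.
rewrite /B /= /bump /= add1n; case: ifPn => nJ.
  rewrite -split_increment_law //; last exact: t_nd.
  by congr (P _); apply/seteqP; split => w Aw; apply/(AE _ _ nJ).
by rewrite thinned_law_setT // => C; exact: mD.
Qed.

End SplitIncrements.

(** * Infinitesimal transition probabilities *)

Section Asymptotics.
Context (R : realType).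

(** The expansion [f h = c + l h + o(h)] as [h] decreases to 0, a common form for the three
    infinitesimal clauses of a GCP. *)
Definition affine_at0 (f : R -> R) (c l : R) : Prop :=
  forall e : R, 0 < e -> \forall h \near 0^'+, `|f h - (c + l * h)| <= e * h.

Lemma eqaddo_affine_at0 (f g : R -> R) c l : (forall h, g h = c + l * h) ->
  f = g +o_ (0^'+) id <-> affine_at0 f c l.
Proof.
move=> gE; split => [/eqaddoP fg e e0|fg].
  have h0 := @nbhs_right_gt R 0.
  near=> h; have hp : 0 < h by near: h.
  rewrite -gE -[X in _ <= e * X](gtr0_norm hp); near: h; exact: fg.
apply/eqaddoP => e e0; have h0 := @nbhs_right_gt R 0.
near=> h; have hp : 0 < h by near: h.
rewrite /= (gtr0_norm hp) -[X in `|X|]/(f h - g h) gE; near: h; exact: fg.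
Unshelve. all: by end_near. Qed.

Lemma eqo_affine_at0 (f : R -> R) : f =o_ (0^'+) id <-> affine_at0 f 0 0.
Proof.
rewrite -(@eqaddo_affine_at0 f (cst 0)) => [|h]; last by rewrite mul0r addr0.
split => [/eqoP fo|/eqaddoP fo].
  by apply/eqaddoP => e e0; have := fo e e0; rewrite subr0.
by apply/eqoP => e e0; have := fo e e0; rewrite subr0.
Qed.

Lemma eq_affine_at0 (f g : R -> R) c l : (forall h, 0 < h -> f h = g h) ->
  affine_at0 f c l -> affine_at0 g c l.
Proof.
move=> fg fa e e0; have h0 := @nbhs_right_gt R 0.
near=> h; rewrite -fg; last by near: h.
by near: h; exact: fa.
Unshelve. all: by end_near. Qed.

End Asymptotics.

Section ThinnedAsymptotics.
Context (R : realType) (d : measure_display) (Omega : measurableType d).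
Variables (P : probability Omega R) (p : R).
Hypothesis p01 : 0 <= p <= 1.

(** Because [thin] is at most 1, the tail of the mixture is dominated by the tail mass of [Y]. *)
Lemma thinned_law_truncate (Y : Omega -> nat) B n :
  (forall B, measurable (Y @^-1` B)) ->
  `|thinned_law P p Y B -
      \sum_(a < n) fine (P (Y @^-1` [set (a : nat)])) * thin p a B| <=
  1 - \sum_(a < n) fine (P (Y @^-1` [set (a : nat)])).
Proof.
move=> mY; set f := fun a => fine (P (Y @^-1` [set a])).
have f0 a : 0 <= f a by rewrite fine_ge0.
have ft0 a : (0 <= (f a * thin p a B)%:E)%E by rewrite lee_fin thinned_term_ge0.
have ft a : ((f a * thin p a B)%:E <= (f a)%:E)%E.
  by rewrite lee_fin ler_piMr ?thin_le1.
pose tB := (\sum_(n <= a <oo) (f a * thin p a B)%:E)%E.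
pose tT := (\sum_(n <= a <oo) (f a)%:E)%E.
have sB := thinned_lawE P p01 mY B; have sT := sum_law_eq1 P mY.
have split (g : nat -> \bar R) : (forall a, 0 <= g a)%E -> (\sum_(a <oo) g a =
    \sum_(a < n) g a + \sum_(n <= a <oo) g a)%E.
  by move=> g0; rewrite (nneseries_split 0 n) // add0n big_mkord.
rewrite split ?sumEFin // -/tB in sB.
rewrite split ?sumEFin // -/tT in sT.
have t0 : (0 <= tB)%E by apply: nneseries_ge0.
have tBT : (tB <= tT)%E by apply: lee_nneseries => a.
case: tT sT tBT => [x| |] //; rewrite -EFinD => -[sT].
case: tB sB t0 => [y| |] // + + xy; rewrite -EFinD => -[sB].
rewrite !lee_fin in xy * => y0.
rewrite -sB addrAC subrr add0r ger0_norm // -[X in X - _]sT.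
by rewrite addrAC subrr add0r.
Qed.

(** As the coefficients [l a] sum to 0, the values up to [k] carry mass [1 - o(h)]. The truncation
    error is therefore [o(h)], with no expansion of the larger values. *)
Lemma thinned_law_affine_at0 (Y : R -> Omega -> nat) (l : nat -> R) k B :
  (forall (h : R) B, 0 < h -> measurable (Y h @^-1` B)) ->
  (forall a, (a <= k)%N ->
    affine_at0 (fun h => fine (P (Y h @^-1` [set a]))) (a == 0%N)%:R (l a)) ->
  \sum_(a < k.+1) l a = 0 ->
  affine_at0 (fun h => thinned_law P p (Y h) B)
    (thin p 0 B) (\sum_(a < k.+1) l a * thin p a B).
Proof.
move=> mY aY l0 e e0.
(* There are [k.+1] remainders, and their sum is used twice: in the truncation bound and, weighted
   by [thin], in the finite sum. Each use may cost [e / 2 * h]. *)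
pose K : R := (2 * k.+1)%:R.
have K0 : 0 < K by rewrite ltr0n.
have : \forall h \near 0^'+, forall a : 'I_k.+1,
    `|fine (P (Y h @^-1` [set (a : nat)])) - ((a == 0 :> nat)%:R + l a * h)| <=
    e / K * h.
  apply: filter_forall => a; apply: aY; last exact: divr_gt0.
  by rewrite -ltnS.
have h0 := @nbhs_right_gt R 0.
move=> nearY; near=> h; have hp : 0 < h by near: h.
have rY : forall a : 'I_k.+1,
    `|fine (P (Y h @^-1` [set (a : nat)])) - ((a == 0 :> nat)%:R + l a * h)| <=
    e / K * h by near: h.
pose r (a : 'I_k.+1) :=
  fine (P (Y h @^-1` [set (a : nat)])) - ((a == 0 :> nat)%:R + l a * h).
have rE (a : 'I_k.+1) :
    fine (P (Y h @^-1` [set (a : nat)])) = (a == 0 :> nat)%:R + l a * h + r a.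
  by rewrite /r addrC subrK.
have {}rY (a : 'I_k.+1) : `|r a| <= e / K * h by exact: rY.
clearbody r.
have s1 (g : nat -> R) : \sum_(a < k.+1) (a == 0 :> nat)%:R * g a = g 0%N.
  by rewrite big_ord_recl /= mul1r big1 ?addr0 // => a _; rewrite mul0r.
have sr : \sum_(a < k.+1) `|r a| <= e / 2 * h.
  apply: (@le_trans _ _ (\sum_(a < k.+1) e / K * h)).
    by apply: ler_sum => a _; exact: rY.
  rewrite sumr_const card_ord -mulr_natl /K natrM.
  have k0 : k.+1%:R != 0 :> R by rewrite pnatr_eq0.
  by rewrite le_eqVlt; apply/orP; left; apply/eqP; field.
have := @thinned_law_truncate (Y h) B k.+1 (fun B => mY h B hp).
under eq_bigr => a _ do rewrite rE !mulrDl.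
under [X in _ <= 1 - X -> _]eq_bigr => a _ do rewrite rE.
rewrite !big_split /= (s1 (fun a => thin p a B)) -mulr_suml l0 mul0r addr0.
have -> : \sum_(a < k.+1) (a == 0 :> nat)%:R = 1 :> R.
  by rewrite -[RHS](s1 (fun=> 1)); apply: eq_bigr => a _; rewrite mulr1.
have -> : \sum_(a < k.+1) l a * h * thin p a B =
    (\sum_(a < k.+1) l a * thin p a B) * h.
  by rewrite mulr_suml; apply: eq_bigr => a _; ring.
set L := \sum_(a < k.+1) l a * thin p a B.
have n1 : `|\sum_(a < k.+1) r a| <= e / 2 * h.
  exact: (le_trans (ler_norm_sum _ _ _)).
have n2 : `|\sum_(a < k.+1) r a * thin p a B| <= e / 2 * h.
  apply: (le_trans (ler_norm_sum _ _ _)); apply: le_trans sr.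
  apply: ler_sum => a _; rewrite normrM ler_piMr //.
  by rewrite ger0_norm ?thin_ge0 ?thin_le1.
move: n1 n2; rewrite !ler_norml => /andP[a1 a2] /andP[a3 a4] /andP[a5 a6].
have eh : e / 2 * h = e * h / 2 by ring.
rewrite {}eh in a1 a2 a3 a4.
by rewrite -[\1_B 0%N]/(thin p 0 B); apply/andP; split; lra.
Unshelve. all: by end_near. Qed.

End ThinnedAsymptotics.

(** * Transition probabilities as increment probabilities *)

Section Transition.
Context (R : realType) (d : measure_display) (Omega : measurableType d).
Variable P : probability Omega R.

(** As [Y 0] is 0, the state at [t] is itself an increment, independent of the one from [t] to
    [t + h]; the positive probability of the conditioning event then cancels. *)
Lemma transition_probE (Y : R -> Omega -> nat) (t : R) n j (h : R) :
  counting_process Y -> (forall w, Y 0 w = 0%N) -> independent_increments P Y ->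
  0 <= t -> 0 <= h -> (0 < P [set w | Y t w = n])%E ->
  transition_prob P Y t n j h = fine (P (increment Y t (t + h) @^-1` [set j])).
Proof.
move=> cY Y0 iY t0 h0 Pn.
pose r n := if n is n'.+1 then if n' is _.+1 then t + h else t else 0.
have th : t <= t + h by rewrite lerDl.
have r_nd : nondecreasing_seq r.
  by apply/nondecreasing_seqP => -[|[|m]] //=.
have mI s s' B : 0 <= s -> 0 <= s' -> measurable (increment Y s s' @^-1` B).
  move=> ? ?; apply: measurable_increment => // u ? u0.
  exact: counting_measurable.
have := mutually_independent_inj 2 (fun m => if m is 0%N then [set n] else [set j])
  (iY r (lexx 0) r_nd) (@inj_id nat).
rewrite !big_ord_recr big_ord0 /= mul1e.
have -> : increment Y 0 t @^-1` [set n] = [set w | Y t w = n].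
  by apply/seteqP; split => w; rewrite /preimage /= /increment Y0 subn0.
have -> : [set w | forall u, (u < 2)%N ->
    (if u is 0%N then [set n] else [set j]) (increment Y (r u) (r u.+1) w)] =
    [set w | Y (t + h) w = (n + j)%N] `&` [set w | Y t w = n].
  apply/seteqP; split => w /=.
    move=> Hw; have := Hw 0%N isT; have := Hw 1%N isT.
    rewrite /increment /= Y0 subn0 => <- <-; split => //.
    by rewrite subnKC //; exact: cp_nondecreasing.
  move=> [Yth Yt] [|[|]] // _ /=; rewrite /increment ?Y0 ?subn0 ?Yth ?Yt //.
  by rewrite addKn.
rewrite /transition_prob /cond_prob => ->.
have fine_quot (x y : \bar R) : x \is a fin_num -> y \is a fin_num ->
    (0 < x)%E -> fine (x * y) / fine x = fine y.
  move: x y => [x| |] [y| |] // _ _ x0; rewrite /= mulrAC divff ?mul1r //.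
  by rewrite gt_eqF.
apply: fine_quot => //; apply: fin_num_measure.
  exact: (counting_measurable [set n] cY t0).
by apply: mI => //; exact: le_trans th.
Qed.

End Transition.

(** * Verification of the GCP axioms for a split component *)

Section SplitGCP.
Context (R : realType) (d : measure_display) (Omega : measurableType d).
Variable P : probability Omega R.
Context (k q : nat) (lambda : nat -> R) (p : 'I_q -> R).
Context (M : R -> Omega -> nat) (xi : nat -> nat -> Omega -> 'I_q) (i : 'I_q).
Hypothesis M_gcp : gcp P k lambda M.
Hypothesis p_gt0 : forall i, 0 < p i.
Hypothesis p_sum1 : \sum_(i < q) p i = 1.
Hypothesis M_rolls : die_rolls P p M xi.

Let X := split_component M xi i.
Let M_cp := gcp_counting M_gcp.
Let M0 := gcp_start M_gcp.

Let pi01 : 0 <= p i <= 1.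
Proof.
rewrite (ltW (p_gt0 i)) -p_sum1 (bigD1 i) //= lerDl sumr_ge0 // => r _.
exact: ltW.
Qed.

(** For a fixed outcome [X] depends on time only through [M], so it is constant wherever [M] is. *)
Lemma split_counting : counting_process X.
Proof.
have nd := @cp_nondecreasing _ _ _ _ M_cp.
split=> [t t0 _ B _|w s t s0 st|w t t0].
- by rewrite setTI; exact: (measurable_split i M_cp M0 M_rolls).
- rewrite /X !(split_componentE xi i M_cp M0) //; last exact: le_trans st.
  by rewrite -(subnKC (nd w s t s0 st)) big_split_ord leq_addr.
- apply/discrete_cvg; change (\forall s \near t^'+, X s w = X t w).
  have Mt := path_eq_right (@cp_right_continuous _ _ _ _ M_cp w) t0.
  have gt_t := @nbhs_right_gt R t.
  near=> s; have ts : t < s by near: s.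
  have Mst : M s w = M t w by near: s.
  rewrite /= /X !(split_componentE xi i M_cp M0) ?Mst //.
  exact: le_trans (ltW ts).
Unshelve. all: by end_near. Qed.

(** The first-order coefficients of the law of [M h]; value 0 receives minus the total rate, so that
    they sum to 0. *)
Let rate a : R :=
  if a is 0%N then - \sum_(1 <= j < k.+1) lambda j else lambda a.

Let sum_rateE (g : nat -> R) : \sum_(a < k.+1) rate a * g a =
  \sum_(1 <= a < k.+1) lambda a * g a -
  (\sum_(1 <= a < k.+1) lambda a) * g 0%N.
Proof.
rewrite big_ord_recl /= mulNr addrC; congr (_ - _).
by rewrite big_add1 /= big_mkord.
Qed.

Let sum_rate : \sum_(a < k.+1) rate a = 0.
Proof.
by rewrite -[LHS]mulr1 mulr_suml (sum_rateE (fun=> 1)) -mulr_suml subrr.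
Qed.

(** The conditioning event at time 0 is certain, so the clauses of the GCP at [t = 0], [n = 0] give
    the law of the increment. *)
Lemma increment_affine_at0 a : (a <= k)%N ->
  affine_at0 (fun h => fine (P (increment M 0 (0 + h) @^-1` [set a])))
    (a == 0%N)%:R (rate a).
Proof.
move=> ak.
have P0 : (0 < P [set w | M 0 w = 0%N])%E.
  rewrite (_ : [set _ | _] = setT) ?probability_setT ?lte01 //.
  by apply/seteqP; split => w // _; exact: M0.
apply: (@eq_affine_at0 _ (transition_prob P M 0 0 a)) => [h h0|].
  apply: transition_probE => //; [|exact: ltW].
  exact: (gcp_independent M_gcp).
case: a ak => [|a] ak /=.
  apply/eqaddo_affine_at0; last exact: (gcp_no_jump M_gcp (lexx 0) P0).
  by move=> h; rewrite mulNr.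
apply/eqaddo_affine_at0; last exact: (gcp_jump M_gcp (lexx 0) P0 (j := a.+1)).
by move=> h; rewrite add0r.
Qed.

(** Stationarity of [M] moves the thinned increment to time 0, which gives one expansion for all [t]
    and [n]. *)
Lemma transition_prob_split t n j : 0 <= t ->
  (0 < P [set w | X t w = n])%E ->
  affine_at0 (transition_prob P X t n j) (thin (p i) 0 [set j])
    (\sum_(1 <= a < k.+1) lambda a * thin (p i) a [set j] -
     (\sum_(1 <= a < k.+1) lambda a) * thin (p i) 0 [set j]).
Proof.
move=> t0 Pn; rewrite -(sum_rateE (fun a => thin (p i) a [set j])).
apply: (@eq_affine_at0 _
  (fun h => thinned_law P (p i) (increment M 0 (0 + h)) [set j])) => [h h0|].
  have th : t <= t + h by rewrite lerDl ltW.
  rewrite transition_probE ?(ltW h0) //.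
  - rewrite (split_increment_law M_cp M0 M_rolls) //=; last first.
      exact: (gcp_independent M_gcp).
    rewrite /thinned_law; congr fine; apply: eq_eseriesr => a _.
    congr ((fine _ * _)%:E); apply: (gcp_stationary M_gcp) => //; exact: ltW.
  - exact: split_counting.
  - by move=> w; rewrite /X (split_componentE xi i M_cp M0) // M0 big_ord0.
  - apply: (split_independent_increments M_cp M0 M_rolls) => //.
    exact: (gcp_independent M_gcp).
apply: thinned_law_affine_at0 => //; last exact: increment_affine_at0.
move=> h B h0; apply: measurable_increment => //.
  by move=> s C s0; exact: counting_measurable.
by rewrite add0r ltW.
Qed.

Lemma split_rate_sum s : split_rate k lambda p i s.+1 =
  \sum_(1 <= a < k.+1) lambda a * thin (p i) a [set s.+1].
Proof.
rewrite split_rateE //.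
have zero m n : (n <= s.+1)%N ->
    \sum_(m <= a < n) lambda a * thin (p i) a [set s.+1] = 0.
  move=> ns; rewrite big_nat_cond big1 // => a /andP[/andP[_ an] _].
  by rewrite thin_set1 bin_small ?mul0r ?mulr0 //; lia.
have [ks|sk] := ltnP k.+1 s.+1; first by rewrite big_geq ?zero //; lia.
rewrite [RHS](@big_cat_nat _ _ _ s.+1) //= zero // add0r.
by apply: eq_bigr => a _; rewrite mulrC.
Qed.

(** The term [j = s] is [p i ^ s] times [lambda s], already positive; the others are nonnegative. *)
Lemma split_rate_gt0 s : (1 <= s <= k)%N -> 0 < split_rate k lambda p i s.
Proof.
case: s => // s sk; rewrite split_rateE //.
have lam_gt0 := gcp_rates_gt0 M_gcp.
rewrite big_ltn //; apply: ltr_wpDr.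
  rewrite big_nat_cond sumr_ge0 // => a /andP[/andP[sa ak] _].
  by rewrite mulr_ge0 ?thin_ge0 // ltW // lam_gt0 //; lia.
by rewrite mulr_gt0 ?lam_gt0 // thin_set1 binn subnn mul1r mulr1 exprn_gt0.
Qed.

Lemma split_component_gcp : gcp P k (split_rate k lambda p i) X.
Proof.
split.
- exact: split_rate_gt0.
- exact: split_counting.
- by move=> w; rewrite /X (split_componentE xi i M_cp M0) // M0 big_ord0.
- apply: (split_independent_increments M_cp M0 M_rolls) => //.
  exact: (gcp_independent M_gcp).
- move=> s t h s0 t0 h0 B.
  have iM := gcp_independent M_gcp.
  rewrite !(split_increment_law M_cp M0 M_rolls iM) ?lerDl //.
  congr EFin; rewrite /thinned_law; congr fine; apply: eq_eseriesr => a _.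
  by congr ((fine _ * _)%:E); exact: (gcp_stationary M_gcp).
- move=> t n t0 Pn; apply/eqaddo_affine_at0; last first.
    exact: transition_prob_split.
  move=> h; rewrite /= indicE mem_set //= mulr1 -mulNr; congr (_ + _ * _).
  (* After exchanging the sums, a jump of size [a] contributes [lambda a] times the probability that
     at least one of its rolls succeeds. *)
  rewrite (eq_big_nat _ _ (F2 := fun s =>
      \sum_(1 <= a < k.+1) lambda a * thin (p i) a [set s])); last first.
    by move=> [|s] // _; exact: split_rate_sum.
  rewrite exchange_big /= -sumrB -sumrN; apply: eq_big_nat => a /andP[_ ak].
  by rewrite -mulr_sumr sum_thin_set1 //; ring.
- move=> t n t0 Pn [|s] // sk; apply/eqaddo_affine_at0; last first.
    exact: transition_prob_split.
  move=> h; rewrite -split_rate_sum /= indicE memNset //=.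
  by rewrite mulr0 subr0 add0r.
- move=> t n t0 Pn [|s] // sk; apply/eqo_affine_at0.
  have := transition_prob_split s.+1 t0 Pn.
  rewrite -split_rate_sum /= indicE memNset //= mulr0 subr0.
  (* For sizes above [k] the rate is an empty sum, so the linear term disappears. *)
  by rewrite /split_rate big_geq.
Qed.

End SplitGCP.

Theorem mainTheorem6 (R : realType) (d : measure_display)
    (Omega : measurableType d) (P : probability Omega R)
    (k q : nat) (lambda : nat -> R) (p : 'I_q -> R)
    (M : R -> Omega -> nat) (xi : nat -> nat -> Omega -> 'I_q) :
  (1 <= k)%N -> (2 <= q)%N ->
  gcp P k lambda M ->
  (forall i, 0 < p i) -> \sum_(i < q) p i = 1 ->
  die_rolls P p M xi ->
  forall i : 'I_q,
    gcp P k (split_rate k lambda p i) (split_component M xi i).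
Proof. by move=> _ _ ? ? ? ? i; exact: split_component_gcp. Qed.
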